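(* Let $n\ge3$, let $\mathcal{K}\subseteq\mathbb{R}^n$ be a proper subdual cone, let $A=A^\top\in\mathbb{R}^{n\times n}$, and let $\{v^1,\dots,v^n\}$ be an orthonormal system of eigenvectors of $A$ corresponding to the eigenvalues $\lambda_1,\dots,\lambda_n$, respectively, such that $v^1\in\operatorname{int}(\mathcal{K}^* )$. Let $$\alpha:=\min\{\langle v^1,y\rangle^2: y\in\mathbb{S}^{n-1}\cap\mathcal{K}\}>0,\qquad \eta:=\max\Bigl\{\frac{\sum_{i=3}^n\langle v^i,y\rangle^2}{\langle v^1,y\rangle^2}: y\in\mathbb{S}^{n-1}\cap\mathcal{K}\Bigr\}>0.$$ Assume that $$\lambda_1<\lambda_2\le\dots\le\lambda_n\le\lambda_2+\delta(\lambda_2-\lambda_1),\qquad\delta\in\{\alpha,1/\eta\}.$$ Then $\lambda_2I_n-A$ is $\mathcal{K}$-copositive. Consequently, the quadratic function $q_A:\mathbb{S}^{n-1}\cap\operatorname{int}(\mathcal{K})\to\mathbb{R}$, $q_A(x)=\langle Ax,x\rangle$, is spherically quasi-convex.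
   Context: $\mathbb{S}^{n-1}=\{x\in\mathbb{R}^n:\|x\|=1\}$. A proper cone is a pointed closed convex cone with nonempty interior; $\mathcal{K}^*=\{y:\langle x,y\rangle\ge0\ \forall x\in\mathcal{K}\}$; $\mathcal{K}$ is subdual if $\mathcal{K}\subseteq\mathcal{K}^*$. A matrix $B$ is $\mathcal{K}$-copositive if $\langle Bx,x\rangle\ge0$ for all $x\in\mathcal{K}$. For $x,y\in\mathbb{S}^{n-1}$ with $y\ne\pm x$ the minimal geodesic from $x$ to $y$ is the constant-speed parametrization $[0,1]\to\mathbb{S}^{n-1}$ of the shorter great-circle arc from $x$ to $y$. A function $f:\mathcal{S}\to\mathbb{R}$ on $\mathcal{S}=\mathbb{S}^{n-1}\cap\operatorname{int}(\mathcal{K})$ is spherically quasi-convex if for every minimal geodesic segment $\gamma:[0,1]\to\mathcal{S}$ the composition $f\circ\gamma$ is quasi-convex in the usual sense. *)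

(* Defs.v *)
From HB Require Import structures.
From mathcomp Require Export all_boot all_order all_algebra.
From mathcomp Require Export all_classical all_reals all_analysis.
Export Order.TTheory GRing.Theory Num.Theory.
Export numFieldNormedType.Exports.

Set Implicit Arguments.
Unset Strict Implicit.
Unset Printing Implicit Defensive.

Local Open Scope classical_set_scope.
Local Open Scope ring_scope.

Definition dot (R : realType) (n : nat) (x y : 'cV[R]_n) : R :=
  \sum_(i < n) x i 0 * y i 0.

(* The library norm on matrices is the sup norm, hence this Euclidean one.
   Open and closed sets need no such care: the matrix topology is the product
   topology, i.e. the usual one. *)
Definition enorm (R : realType) (n : nat) (x : 'cV[R]_n) : R :=
  Num.sqrt (dot x x).

Definition unit_sphere (R : realType) (n : nat) : set 'cV[R]_n :=
  [set x | enorm x = 1].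

Arguments unit_sphere : clear implicits.

Definition proper_cone (R : realType) (n : nat) (K : set 'cV[R]_n) : Prop :=
  [/\ forall (t : R) (x : 'cV[R]_n), 0 <= t -> K x -> K (t *: x),
      convex_set (K : set (convex_lmodType 'cV[R]_n)),
      closed K,
      forall x : 'cV[R]_n, K x -> K (- x) -> x = 0 &
      K° !=set0].

Definition dual_cone (R : realType) (n : nat) (K : set 'cV[R]_n) :
    set 'cV[R]_n :=
  [set y | forall x, K x -> 0 <= dot x y].

Definition subdual (R : realType) (n : nat) (K : set 'cV[R]_n) : Prop :=
  K `<=` dual_cone K.

Definition copositive (R : realType) (n : nat) (K : set 'cV[R]_n)
    (B : 'M[R]_n) : Prop :=
  forall x, K x -> 0 <= dot (B *m x) x.

Definition quad_form (R : realType) (n : nat) (A : 'M[R]_n) (x : 'cV[R]_n) : R :=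
  dot (A *m x) x.

(* With [u] a unit vector orthogonal to [x], [s |-> cos s *: x + sin s *: u] is
   the unit-speed great circle leaving [x] in direction [u]; running it at
   speed [theta] for a unit of time traces an arc of length [theta], which is
   the shorter one between its endpoints exactly when [theta < pi]. Nothing is
   required of [g] outside of [0, 1]. *)
Definition minimal_geodesic (R : realType) (n : nat) (x y : 'cV[R]_n)
    (g : R -> 'cV[R]_n) : Prop :=
  [/\ unit_sphere R n x, unit_sphere R n y, y <> x, y <> - x &
      exists (u : 'cV[R]_n) (theta : R),
        [/\ unit_sphere R n u, dot x u = 0, 0 < theta < pi, g 1 = y &
            forall t : R, 0 <= t <= 1 ->
              g t = cos (t * theta) *: x + sin (t * theta) *: u]].

Definition quasiconvex_on (R : realType) (D : set R) (h : R -> R) : Prop :=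
  forall s t k : R, D s -> D t -> 0 <= k <= 1 ->
    h (k * s + (1 - k) * t) <= Num.max (h s) (h t).

Definition spherically_quasiconvex (R : realType) (n : nat)
    (S : set 'cV[R]_n) (f : 'cV[R]_n -> R) : Prop :=
  forall (x y : 'cV[R]_n) (g : R -> 'cV[R]_n),
    minimal_geodesic x y g ->
    (forall t : R, 0 <= t <= 1 -> S (g t)) ->
    quasiconvex_on [set t | 0 <= t <= 1] (f \o g).

(* Indices are 0-based: these are the mathematical indices 1, 2 and n. *)
Definition idx1 (n : nat) (hn : (3 <= n)%N) : 'I_n :=
  Ordinal (leq_trans (isT : (0 < 3)%N) hn).

Definition idx2 (n : nat) (hn : (3 <= n)%N) : 'I_n :=
  Ordinal (leq_trans (isT : (1 < 3)%N) hn).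

Definition idxn (n : nat) (hn : (3 <= n)%N) : 'I_n := rev_ord (idx1 hn).

(* Main.v *)
Require Import Defs.
From mathcomp Require Import ring lra.

(** Write [c_i] for the coordinate of [x] along the [i]-th eigenvector, counted
    from 1, and call the sum of the [c_i ^+ 2] with [i >= 3] the tail of [x].

    The vector [v_1] is interior to the dual cone, so [c_1 > 0] on [K] minus the
    origin ([interior_dual_cone_gt0]). The unit vectors of [K] form a compact set
    ([compact_unit_sphere]) on which [c_1 ^+ 2] and the quotient tail over
    [c_1 ^+ 2] are continuous, hence attain their extrema alpha and eta. The
    first one is positive because [c_1 > 0]; the second because [K] has interior
    points, which cannot all lie in the span of [v_1] and [v_2].

    In the eigenbasis, the form of [lambda_2 I - A] at [x] is the sum of the
    [(lambda_2 - lambda_i) * c_i ^+ 2]. The only positive term is the first one,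
    the second vanishes, and the spectral bound makes the others at least
    [- delta * (lambda_2 - lambda_1)] times the tail. The sum is therefore
    nonnegative as soon as delta times the tail is at most [c_1 ^+ 2]
    ([copositive_of_tail_bound]). For [delta = 1 / eta] this is the maximality
    of eta; for [delta = alpha] it holds because on unit vectors the tail is at
    most 1 and [c_1 ^+ 2] at least alpha.

    Quasi-convexity amounts to the convexity of the sublevel sets along arcs
    ([spherically_quasiconvex_quad_form]). At a level [m >= lambda_2]
    copositivity says that the sublevel set is everything. At a level
    [m < lambda_2] the form of [B := A - m I] is nonnegative on the hyperplane
    [c_1 = 0], so it has at most one negative eigenvalue; its nonpositive set
    is a double Lorentz-like cone, whose half [c_1 > 0] is convex
    ([quad_form_le0_comb]). A point of the arc between two points is a
    nonnegative combination of them up to a positive factor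
    ([great_circle_comb]), so it stays in that half cone. *)

Set Implicit Arguments.
Unset Strict Implicit.
Unset Printing Implicit Defensive.

Local Open Scope classical_set_scope.
Local Open Scope ring_scope.

(** * Inner product *)

Lemma dotE (R : realType) n (x y : 'cV[R]_n) : dot x y = (x^T *m y) 0 0.
Proof. by rewrite mxE; apply: eq_bigr => i _; rewrite mxE. Qed.

Lemma dotC (R : realType) n (x y : 'cV[R]_n) : dot x y = dot y x.
Proof. by apply: eq_bigr => i _; rewrite mulrC. Qed.

Lemma dotDr (R : realType) n (x y z : 'cV[R]_n) :
  dot x (y + z) = dot x y + dot x z.
Proof. by rewrite !dotE mulmxDr mxE. Qed.

Lemma dotZr (R : realType) n (a : R) (x y : 'cV[R]_n) :
  dot x (a *: y) = a * dot x y.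
Proof. by rewrite !dotE -scalemxAr mxE. Qed.

Lemma dotNr (R : realType) n (x y : 'cV[R]_n) : dot x (- y) = - dot x y.
Proof. by rewrite -scaleN1r dotZr mulN1r. Qed.

Lemma dotDl (R : realType) n (x y z : 'cV[R]_n) :
  dot (x + y) z = dot x z + dot y z.
Proof. by rewrite !(dotC _ z) dotDr. Qed.

Lemma dotZl (R : realType) n (a : R) (x y : 'cV[R]_n) :
  dot (a *: x) y = a * dot x y.
Proof. by rewrite !(dotC _ y) dotZr. Qed.

Lemma dotNl (R : realType) n (x y : 'cV[R]_n) : dot (- x) y = - dot x y.
Proof. by rewrite !(dotC _ y) dotNr. Qed.

Lemma dot_ge0 (R : realType) n (x : 'cV[R]_n) : 0 <= dot x x.
Proof. by apply: sumr_ge0 => i _; rewrite -expr2 sqr_ge0. Qed.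

Lemma dot_eq0 (R : realType) n (x : 'cV[R]_n) : (dot x x == 0) = (x == 0).
Proof.
apply/eqP/eqP => [/eqP|->]; last first.
  by rewrite /dot big1// => i _; rewrite mxE mul0r.
rewrite psumr_eq0 => [/allP x0|i _]; last by rewrite -expr2 sqr_ge0.
apply/colP => i; rewrite mxE; apply/eqP.
by have := x0 i (mem_index_enum i); rewrite -expr2 sqrf_eq0.
Qed.

Lemma dot_gt0 (R : realType) n (x : 'cV[R]_n) : (0 < dot x x) = (x != 0).
Proof. by rewrite lt_neqAle dot_ge0 andbT eq_sym dot_eq0. Qed.

Lemma dot_mulmx (R : realType) n (A : 'M[R]_n) (x y : 'cV[R]_n) :
  dot (A *m x) y = dot x (A^T *m y).
Proof. by rewrite !dotE trmx_mul mulmxA. Qed.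

Lemma unit_sphereE (R : realType) n (x : 'cV[R]_n) :
  unit_sphere R n x = (dot x x = 1).
Proof.
rewrite /unit_sphere /enorm /=; apply/propext; split=> [x1|->].
  by rewrite -(sqr_sqrtr (dot_ge0 x)) x1 expr1n.
exact: sqrtr1.
Qed.

Lemma unit_sphere_neq0 (R : realType) n (x : 'cV[R]_n) :
  unit_sphere R n x -> x != 0.
Proof. by rewrite unit_sphereE -dot_gt0 => ->. Qed.

(** * Spectral expansion *)

(** A square matrix [W] whose rows are orthonormal also satisfies
    [W^T *m W = 1], so it preserves the inner product. *)
Lemma parseval (R : realType) n (v : 'I_n -> 'cV[R]_n) (x y : 'cV[R]_n) :
  (forall i j, dot (v i) (v j) = (i == j)%:R) ->
  dot x y = \sum_(i < n) dot (v i) x * dot (v i) y.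
Proof.
move=> hv; pose W : 'M[R]_n := \matrix_(i, j) v i j 0.
have WW : W^T *m W = 1%:M.
  apply: mulmx1C; apply/matrixP => i j; rewrite !mxE -hv.
  by apply: eq_bigr => k _; rewrite !mxE.
have WE z i : (W *m z) i 0 = dot (v i) z.
  by rewrite mxE; apply: eq_bigr => k _; rewrite !mxE.
transitivity (dot (W *m x) (W *m y)).
  by rewrite dot_mulmx mulmxA WW mul1mx.
by apply: eq_bigr => i _; rewrite !WE.
Qed.

Lemma quad_form_spectral (R : realType) n (A : 'M[R]_n)
    (v : 'I_n -> 'cV[R]_n) (lambda : 'I_n -> R) (x : 'cV[R]_n) :
  A = A^T -> (forall i j, dot (v i) (v j) = (i == j)%:R) ->
  (forall i, A *m v i = lambda i *: v i) ->
  quad_form A x = \sum_(i < n) lambda i * dot (v i) x ^+ 2.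
Proof.
move=> hA hv hl; rewrite /quad_form (parseval _ _ hv); apply: eq_bigr => i _.
by rewrite dotC dot_mulmx -hA hl dotZr expr2 mulrA (dotC x).
Qed.

(** * Quasi-convexity along great circles *)

Lemma quad_form_comb (R : realType) n (B : 'M[R]_n) (a b : R)
    (x y : 'cV[R]_n) : B = B^T ->
  quad_form B (a *: x + b *: y) = a ^+ 2 * quad_form B x
    + 2 * (a * b) * dot (B *m x) y + b ^+ 2 * quad_form B y.
Proof.
move=> hB; rewrite /quad_form mulmxDr -!scalemxAr !(dotDl, dotDr, dotZl, dotZr).
rewrite [dot (B *m y) x]dotC [dot x _]dotC.
have -> : dot (B *m y) x = dot (B *m x) y.
  by rewrite dot_mulmx -hB dotC.
by ring.
Qed.

Lemma quad_form_sub_scalar (R : realType) n (A : 'M[R]_n) (c : R)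
    (x : 'cV[R]_n) :
  quad_form (A - c%:M) x = quad_form A x - c * dot x x.
Proof.
by rewrite /quad_form mulmxBl mul_scalar_mx dotDl dotNl dotZl.
Qed.

(** With [x] and [y] on the positive side of the hyperplane orthogonal to [e],
    the vector [dot e y *: x - dot e x *: y] lies in that hyperplane; expanding
    [0 <= quad_form B] at it bounds the cross term [dot (B *m x) y] above by
    nonpositive quantities. *)
Lemma quad_form_le0_comb (R : realType) n (B : 'M[R]_n) (e x y : 'cV[R]_n)
    (a b : R) : B = B^T ->
  (forall w, dot e w = 0 -> 0 <= quad_form B w) ->
  0 < dot e x -> 0 < dot e y ->
  quad_form B x <= 0 -> quad_form B y <= 0 -> 0 <= a -> 0 <= b ->
  quad_form B (a *: x + b *: y) <= 0.
Proof.
move=> hB Be ex ey Bx By a0 b0.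
have cross : dot (B *m x) y <= 0.
  have /Be : dot e (dot e y *: x + (- dot e x) *: y) = 0.
    by rewrite dotDr !dotZr; ring.
  rewrite quad_form_comb// => H.
  have xy0 : 0 < dot e x * dot e y by rewrite mulr_gt0.
  have H1 : dot e y ^+ 2 * quad_form B x <= 0.
    by rewrite mulr_ge0_le0// sqr_ge0.
  have H2 : (- dot e x) ^+ 2 * quad_form B y <= 0.
    by rewrite mulr_ge0_le0// sqr_ge0.
  by rewrite -(pmulr_rle0 _ xy0); nra.
rewrite quad_form_comb//.
have H1 : a ^+ 2 * quad_form B x <= 0 by rewrite mulr_ge0_le0// sqr_ge0.
have H2 : b ^+ 2 * quad_form B y <= 0 by rewrite mulr_ge0_le0// sqr_ge0.
have H3 : 2 * (a * b) * dot (B *m x) y <= 0.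
  by rewrite mulr_ge0_le0// !mulr_ge0.
by lra.
Qed.

(** The spherical interpolation formula, multiplied by [sin (r - p)]: the
    coefficients on the right are nonnegative when [p <= q <= r <= p + pi], and
    no division is needed. *)
Lemma great_circle_comb (R : realType) (V : lmodType R) (x u : V) (p q r : R) :
  sin (r - p) *: (cos q *: x + sin q *: u) =
  sin (r - q) *: (cos p *: x + sin p *: u)
    + sin (q - p) *: (cos r *: x + sin r *: u).
Proof.
rewrite !scalerDr !scalerA addrACA -!scalerDl.
by congr (_ *: x + _ *: u); rewrite !sinB; ring.
Qed.

(** At a level [m >= mu] the sublevel set is all of [S]; below [mu] the form of
    [A - m%:M] is nonnegative on the hyperplane orthogonal to [e], and the
    convexity of its nonpositive half cone applies. *)
Lemma spherically_quasiconvex_quad_form (R : realType) n (A : 'M[R]_n)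
    (e : 'cV[R]_n) (mu : R) (S : set 'cV[R]_n) : A = A^T ->
  (forall w, dot e w = 0 -> mu * dot w w <= quad_form A w) ->
  S `<=` unit_sphere R n ->
  (forall x, S x -> 0 < dot e x) ->
  (forall x, S x -> quad_form A x <= mu) ->
  spherically_quasiconvex S (quad_form A).
Proof.
move=> hA gap Su Se Smu x y g [_ _ _ _ [u [th [_ _ /andP[th0 thpi] _ gE]]]] Sg.
have key s t k : 0 <= s -> t <= 1 -> s <= t -> 0 <= k <= 1 ->
    quad_form A (g (k * s + (1 - k) * t)) <=
      Num.max (quad_form A (g s)) (quad_form A (g t)).
  move=> s0 t1 st /andP[k0 k1]; set r := k * s + (1 - k) * t.
  have [sr rt] : s <= r /\ r <= t by rewrite /r; split; nra.
  have Ss : S (g s) by apply: Sg; lra.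
  have St : S (g t) by apply: Sg; lra.
  have Sr : S (g r) by apply: Sg; lra.
  have [st_eq|s_neq_t] := eqVneq s t.
    by rewrite /r -st_eq -mulrDl addrC subrK mul1r maxxx.
  have {s_neq_t}st' : s < t by rewrite lt_neqAle s_neq_t.
  set m := Num.max _ _.
  have [mum|/ltW mmu] := leP mu m; first exact: le_trans (Smu _ Sr) mum.
  pose B := A - m%:M.
  have BE z : S z -> quad_form B z = quad_form A z - m.
    by move=> /Su; rewrite unit_sphereE quad_form_sub_scalar => ->; rewrite mulr1.
  have Bs : quad_form B (g s) <= 0 by rewrite BE// subr_le0 le_max lexx.
  have Bt : quad_form B (g t) <= 0 by rewrite BE// subr_le0 le_max lexx orbT.
  have hB : B = B^T by rewrite /B linearB /= -hA tr_scalar_mx.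
  have Be w : dot e w = 0 -> 0 <= quad_form B w.
    move=> /gap; rewrite quad_form_sub_scalar subr_ge0; apply: le_trans.
    by rewrite ler_wpM2r// dot_ge0.
  have p0 : 0 < sin (t * th - s * th).
    by apply: sin_gt0_pi; rewrite -mulrBl; apply/andP; split; nra.
  have a0 : 0 <= sin (t * th - r * th).
    by apply: sin_ge0_pi; rewrite -mulrBl; apply/andP; split; nra.
  have b0 : 0 <= sin (r * th - s * th).
    by apply: sin_ge0_pi; rewrite -mulrBl; apply/andP; split; nra.
  have := quad_form_le0_comb hB Be (Se _ Ss) (Se _ St) Bs Bt a0 b0.
  rewrite (gE s) ?(gE t); try lra.
  rewrite -great_circle_comb -gE; last by lra.
  rewrite /quad_form -scalemxAr dotZl dotZr -/(quad_form B (g r)).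
  by rewrite !pmulr_rle0// BE// subr_le0.
(* Exchanging the endpoints replaces k by 1 - k. *)
move=> s t k /= /andP[s0 s1] /andP[t0 t1] k01.
have [st|/ltW ts] := leP s t; first exact: key.
rewrite maxC addrC -[X in (1 - k) * t + X * s](subKr 1).
by apply: key => //; lra.
Qed.

(** * Topology of spheres and cones *)

(** Transports the compactness of boxes from row vectors to column vectors. *)
Lemma trmx_continuous (R : realType) m n :
  continuous (@trmx R m n : 'M[R]_(m, n) -> 'M[R]_(n, m)).
Proof.
move=> M s /nbhs_ballP[e e0 es]; apply/nbhs_ballP; exists e => //= N [_ MN].
by apply: es; split=> // i j; rewrite !mxE.
Qed.

Lemma continuous_sum (R : realType) (T : topologicalType) (I : Type)
    (r : seq I) (P : pred I) (F : I -> T -> R) :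
  (forall i, P i -> continuous (F i)) ->
  continuous (fun x => \sum_(i <- r | P i) F i x).
Proof.
move=> Fc x; apply: cvg_big => [y|i Pi]; first exact: add_continuous.
exact: Fc.
Qed.

Lemma dot_continuous (R : realType) n (w : 'cV[R]_n) : continuous (dot w).
Proof.
apply: continuous_sum => i _ x.
by apply: (@continuousM _ _ (fun=> w i 0));
  [exact: cst_continuous|exact: coord_continuous].
Qed.

(** The sphere is a closed subset of the cube of half-side 1. *)
Lemma compact_unit_sphere (R : realType) n : compact (unit_sphere R n).
Proof.
pose C : set 'cV[R]_n :=
  [set x^T | x in [set r : 'rV[R]_n | forall i, `[-1, 1]%classic (r ord0 i)]].
have cC : compact C.
  apply: continuous_compact.
    by apply: continuous_subspaceT => r; exact: trmx_continuous.
  apply: (@rV_compact R n (fun=> `[(-1 : R), 1]%classic)) => i.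
  exact: segment_compact.
apply: (subclosed_compact _ cC).
  have -> : unit_sphere R n = (fun x => dot x x) @^-1` [set t : R | t = 1].
    by rewrite funeqE => x; rewrite unit_sphereE.
  apply: preimage_closed (@closed_eq R 1) => x _.
  apply: continuous_sum x => i _ x.
  by apply: (@continuousM _ _ (fun y : 'cV[R]_n => y i 0));
    exact: coord_continuous.
move=> x; rewrite unit_sphereE => x1; exists x^T; last by rewrite trmxK.
move=> i; rewrite /= in_itv /= mxE -ler_norml.
rewrite -(@ler_pXn2r _ 2)// ?nnegrE// real_normK ?num_real// expr1n -x1.
rewrite /dot (bigD1 i)//= expr2 lerDl; apply: sumr_ge0 => j _.
by rewrite -expr2 sqr_ge0.
Qed.

Lemma interior_ray (R : realType) n (S : set 'cV[R]_n) (x w : 'cV[R]_n) :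
  S° x -> exists2 t : R, 0 < t & S (x + t *: w).
Proof.
move=> /nbhs_ballP[e /= e0 eS].
have w1 : 0 < `|w| + 1 by rewrite ltr_wpDl.
exists (e / (`|w| + 1)); first by rewrite divr_gt0.
apply: eS; rewrite -ball_normE /= opprD addNKr normrN normrZ.
rewrite ger0_norm; last by rewrite ltW// divr_gt0.
by rewrite -mulrA gtr_pMr// mulrC ltr_pdivrMr// mul1r ltrDl.
Qed.

(** The dual cone still contains [e - t *: x] for some [t > 0], whence
    [dot e x >= t * dot x x]. *)
Lemma interior_dual_cone_gt0 (R : realType) n (K : set 'cV[R]_n)
    (e x : 'cV[R]_n) : (dual_cone K)° e -> K x -> x != 0 -> 0 < dot e x.
Proof.
move=> /(interior_ray (- x))[t t0 Ke] Kx x0.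
have := Ke x Kx; rewrite scalerN dotDr dotNr dotZr subr_ge0 dotC.
by apply: lt_le_trans; rewrite mulr_gt0// dot_gt0.
Qed.

Lemma cone_normalize (R : realType) n (K : set 'cV[R]_n) (x : 'cV[R]_n) :
  (forall (t : R) x, 0 <= t -> K x -> K (t *: x)) -> K x -> x != 0 ->
  (unit_sphere R n `&` K) ((enorm x)^-1 *: x).
Proof.
move=> Kcone Kx x0; split; last by apply: Kcone; rewrite ?invr_ge0 ?sqrtr_ge0.
rewrite unit_sphereE dotZl dotZr mulrA -expr2 exprVn sqr_sqrtr ?dot_ge0//.
by rewrite mulVf// dot_eq0.
Qed.

(** * Attained extrema *)

Lemma inf_lbound_in (R : realType) (S : set R) (m : R) :
  S m -> lbound S m -> inf S = m.
Proof.
move=> Sm lb; apply/eqP; rewrite eq_le; apply/andP; split.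
  by apply: ge_inf => //; exists m.
by apply: lb_le_inf => //; exists m.
Qed.

Lemma sup_ubound_in (R : realType) (S : set R) (m : R) :
  S m -> ubound S m -> sup S = m.
Proof.
move=> Sm ub; apply/eqP; rewrite eq_le; apply/andP; split.
  by apply: ge_sup => //; exists m.
by apply: ub_le_sup => //; exists m.
Qed.

Lemma compact_inf_image (T : topologicalType) (R : realType) (f : T -> R)
    (A : set T) : A !=set0 -> compact A -> {within A, continuous f} ->
  (f @` A) (inf (f @` A)) /\ lbound (f @` A) (inf (f @` A)).
Proof.
move=> A0 cA cf; have [c] := compact_EVT_min A0 cA cf.
rewrite inE => Ac cmin.
have fc : (f @` A) (f c) by exists c.
have lb : lbound (f @` A) (f c) by move=> _ [y Ay <-]; apply: cmin; rewrite inE.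
by rewrite (inf_lbound_in fc lb).
Qed.

Lemma compact_sup_image (T : topologicalType) (R : realType) (f : T -> R)
    (A : set T) : A !=set0 -> compact A -> {within A, continuous f} ->
  (f @` A) (sup (f @` A)) /\ ubound (f @` A) (sup (f @` A)).
Proof.
move=> A0 cA cf; have [c] := compact_EVT_max A0 cA cf.
rewrite inE => Ac cmax.
have fc : (f @` A) (f c) by exists c.
have ub : ubound (f @` A) (f c) by move=> _ [y Ay <-]; apply: cmax; rewrite inE.
by rewrite (sup_ubound_in fc ub).
Qed.

(** * Copositivity and the main theorem *)

(** In the eigenbasis the second term of the form is zero; the spectral bound
    controls the later ones from below by the tail sum, which the last
    hypothesis compares with the first term. *)
Lemma copositive_of_tail_bound (R : realType) n (hn : (3 <= n)%N)
    (K : set 'cV[R]_n) (A : 'M[R]_n) (v : 'I_n -> 'cV[R]_n)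
    (lambda : 'I_n -> R) (delta : R) : A = A^T ->
  (forall i j, dot (v i) (v j) = (i == j)%:R) ->
  (forall i, A *m v i = lambda i *: v i) ->
  lambda (idx1 hn) <= lambda (idx2 hn) ->
  (forall i : 'I_n, (2 <= i)%N -> lambda i <=
    lambda (idx2 hn) + delta * (lambda (idx2 hn) - lambda (idx1 hn))) ->
  (forall x, K x ->
    delta * \sum_(i < n | (2 <= i)%N) dot (v i) x ^+ 2
      <= dot (v (idx1 hn)) x ^+ 2) ->
  copositive K ((lambda (idx2 hn))%:M - A).
Proof.
move=> hA hv hl l12 ln tail x /tail {}tail.
set mu := lambda (idx2 hn) in l12 ln *.
set gap := mu - lambda (idx1 hn) in ln.
have gap0 : 0 <= gap by rewrite subr_ge0.
have -> : dot ((mu%:M - A) *m x) x = mu * dot x x - quad_form A x.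
  by rewrite mulmxBl mul_scalar_mx dotDl dotNl dotZl.
rewrite (quad_form_spectral _ hA hv hl) (parseval _ _ hv) mulr_sumr -sumrB.
rewrite (bigD1 (idx1 hn))//=.
have tail_le : - (gap * (delta * \sum_(i < n | (2 <= i)%N) dot (v i) x ^+ 2)) <=
    \sum_(i < n | i != idx1 hn) (mu * (dot (v i) x * dot (v i) x)
      - lambda i * dot (v i) x ^+ 2).
  rewrite [leRHS](bigD1 (idx2 hn))//= -expr2 -/mu subrr add0r.
  rewrite [leRHS](eq_bigl (fun i : 'I_n => (2 <= i)%N)); last first.
    by case=> [[|[|i]] ?]; rewrite -!val_eqE.
  rewrite !mulr_sumr -sumrN; apply: ler_sum => i i2.
  have := sqr_ge0 (dot (v i) x); have := ln i i2; rewrite -expr2.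
  by move=> ? ?; nra.
apply: le_trans (lerD (lexx _) tail_le).
by rewrite -expr2 -mulrBl -mulrBr mulr_ge0// subr_ge0.
Qed.

Lemma quad_form_ge_of_orthogonal (R : realType) n (hn : (3 <= n)%N)
    (A : 'M[R]_n) (v : 'I_n -> 'cV[R]_n) (lambda : 'I_n -> R)
    (w : 'cV[R]_n) (mu : R) : A = A^T ->
  (forall i j, dot (v i) (v j) = (i == j)%:R) ->
  (forall i, A *m v i = lambda i *: v i) ->
  (forall i, i != idx1 hn -> mu <= lambda i) ->
  dot (v (idx1 hn)) w = 0 -> mu * dot w w <= quad_form A w.
Proof.
move=> hA hv hl mul w0.
rewrite (quad_form_spectral _ hA hv hl) (parseval _ _ hv) mulr_sumr.
apply: ler_sum => i _; have [->|i1] := eqVneq i (idx1 hn).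
  by rewrite w0 expr0n !mulr0.
by rewrite -expr2 ler_wpM2r ?sqr_ge0// mul.
Qed.

Theorem theorem5p4p3 (R : realType) (n : nat) (hn : (3 <= n)%N)
    (K : set 'cV[R]_n) (A : 'M[R]_n)
    (v : 'I_n -> 'cV[R]_n) (lambda : 'I_n -> R)
    (hK : proper_cone K) (hKsub : subdual K) (hA : A = A^T)
    (hv_orthonormal : forall i j : 'I_n, dot (v i) (v j) = (i == j)%:R)
    (hv_eigen : forall i : 'I_n, A *m v i = lambda i *: v i)
    (hv1 : (dual_cone K)° (v (idx1 hn))) :
  let alpha_set : set R :=
    [set dot (v (idx1 hn)) y ^+ 2 | y in unit_sphere R n `&` K] in
  let eta_set : set R :=
    [set (\sum_(i < n | (2 <= i)%N) dot (v i) y ^+ 2)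
           / dot (v (idx1 hn)) y ^+ 2 | y in unit_sphere R n `&` K] in
  let alpha : R := inf alpha_set in
  let eta : R := sup eta_set in
  (* alpha is a minimum, eta is a maximum, and both are positive *)
  [/\ alpha_set alpha, lbound alpha_set alpha & 0 < alpha] /\
  [/\ eta_set eta, ubound eta_set eta & 0 < eta] /\
  forall delta : R, delta = alpha \/ delta = 1 / eta ->
    lambda (idx1 hn) < lambda (idx2 hn) ->
    (forall i j : 'I_n, (1 <= i)%N -> (i <= j)%N -> lambda i <= lambda j) ->
    lambda (idxn hn) <=
      lambda (idx2 hn) + delta * (lambda (idx2 hn) - lambda (idx1 hn)) ->
    copositive K ((lambda (idx2 hn))%:M - A) /\
    spherically_quasiconvex (unit_sphere R n `&` K°) (quad_form A).
Proof.
move=> alpha_set eta_set alpha eta.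
have [Kcone _ Kclosed _ [x0 intK0]] := hK.
set SK := unit_sphere R n `&` K.
set c1 := dot (v (idx1 hn)).
pose tail y := \sum_(i < n | (2 <= i)%N) dot (v i) y ^+ 2.
have c1_gt0 y : SK y -> 0 < c1 y.
  by move=> [/unit_sphere_neq0 y0 Ky]; exact: interior_dual_cone_gt0 hv1 Ky y0.
(* The vectors with vanishing tail form the proper subspace spanned by the
   first two eigenvectors, which cannot contain the open set int K: a point of
   int K pushed along the third eigenvector leaves it. *)
have [z SKz tailz] : exists2 z, SK z & 0 < tail z.
  pose i3 : 'I_n := Ordinal hn.
  have [y Ky y3] : exists2 y, K y & dot (v i3) y != 0.
    have [d3|] := eqVneq (dot (v i3) x0) 0; last first.
      by exists x0 => //; exact: interior_subset intK0.
    have [t t0 Kt] := interior_ray (v i3) intK0.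
    by exists (x0 + t *: v i3) => //;
      rewrite dotDr dotZr hv_orthonormal eqxx d3 add0r mulr1 gt_eqF.
  have y0 : y != 0.
    by apply: contraNneq y3 => ->; rewrite -(scale0r y) dotZr mul0r.
  exists ((enorm y)^-1 *: y); first exact: cone_normalize.
  rewrite /tail (bigD1 i3)//= ltr_wpDr//.
    by apply: sumr_ge0 => i _; exact: sqr_ge0.
  rewrite dotZr exprn_even_gt0//= mulf_neq0// invr_neq0//.
  by rewrite sqrtr_eq0 -ltNge dot_gt0.
have SK0 : SK !=set0 by exists z.
have cSK : compact SK by apply: compact_closedI => //; exact: compact_unit_sphere.
have sqr_continuous w : continuous (fun y : 'cV[R]_n => dot w y ^+ 2).
  move=> y; apply: (@continuousM _ _ (dot w) (dot w)); exact: dot_continuous.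
have [alpha_in alpha_lb] : alpha_set alpha /\ lbound alpha_set alpha.
  by apply: compact_inf_image => //; apply: continuous_subspaceT => y;
    exact: sqr_continuous.
(* The denominator does not vanish on SK, which is all that continuity within
   SK requires. *)
have [eta_in eta_ub] : eta_set eta /\ ubound eta_set eta.
  apply: compact_sup_image => //; apply: continuous_in_subspaceT => y.
  rewrite inE => /c1_gt0 y1.
  apply: (@continuousM _ _ tail (fun y => (c1 y ^+ 2)^-1)).
    by apply: continuous_sum => i _; exact: sqr_continuous.
  by apply: continuousV; [rewrite expf_neq0// gt_eqF|exact: sqr_continuous].
have alpha_gt0 : 0 < alpha.
  by have [y /c1_gt0 y1 <-] := alpha_in; rewrite exprn_gt0.
have eta_gt0 : 0 < eta.
  apply: lt_le_trans (eta_ub _ _); last by exists z; [exact: SKz|].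
  by rewrite divr_gt0// exprn_gt0// c1_gt0.
split; first by split.
split; first by split.
move=> delta hdelta l12 lmono ln.
(* For alpha, the tail of a unit vector is at most its squared norm 1. *)
have tail_bound y : SK y -> delta * tail y <= c1 y ^+ 2.
  move=> SKy; have [->|->] := hdelta.
    have tail1 : tail y <= 1.
      have [+ _] := SKy; rewrite unit_sphereE (parseval _ _ hv_orthonormal) => <-.
      rewrite /tail big_mkcond; apply: ler_sum => i _.
      by case: ifP => _; rewrite -expr2 ?sqr_ge0.
    have : alpha <= c1 y ^+ 2 by apply: alpha_lb; exists y.
    by apply: le_trans; rewrite ler_piMr// ltW.
  have : tail y / c1 y ^+ 2 <= eta by apply: eta_ub; exists y.
  rewrite ler_pdivrMr ?exprn_gt0 ?c1_gt0// => h.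
  by rewrite mulrAC mul1r ler_pdivrMr// mulrC.
(* Both sides are homogeneous of degree 2. *)
have tail_bound_cone x : K x -> delta * tail x <= c1 x ^+ 2.
  move=> Kx; have [->|x_neq0] := eqVneq x 0.
    have d0 w : dot w (0 : 'cV[R]_n) = 0.
      by rewrite -(scale0r w) dotZr mul0r.
    by rewrite /c1 /tail d0 big1 ?mulr0 ?expr0n// => i _; rewrite d0 expr0n.
  have := tail_bound _ (cone_normalize Kcone Kx x_neq0).
  set r := (enorm x)^-1.
  have r0 : 0 < r ^+ 2.
    by rewrite exprn_even_gt0//= invr_neq0// sqrtr_eq0 -ltNge dot_gt0.
  rewrite /c1 dotZr exprMn /tail.
  under eq_bigr do rewrite dotZr exprMn.
  by rewrite -mulr_sumr mulrCA ler_pM2l.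
have cop : copositive K ((lambda (idx2 hn))%:M - A).
  apply: (@copositive_of_tail_bound _ _ _ _ _ v _ delta) => //.
    exact: ltW.
  move=> i i2; apply: le_trans (lmono i (idxn hn) _ _) ln; first exact: ltnW.
  by rewrite /= subn1 -ltnS prednK// (leq_trans _ hn).
split=> //.
apply: (@spherically_quasiconvex_quad_form _ _ _ (v (idx1 hn))
  (lambda (idx2 hn))) => //.
- move=> w; apply: quad_form_ge_of_orthogonal hv_orthonormal hv_eigen _ => //.
  move=> i; rewrite -val_eqE /= -lt0n => i0; exact: lmono.
- by move=> x [Sx Kx]; apply: c1_gt0; split=> //; exact: interior_subset Kx.
- move=> x [Sx /interior_subset/cop].
  rewrite mulmxBl mul_scalar_mx dotDl dotNl dotZl.
  by move: Sx; rewrite unit_sphereE => ->; rewrite mulr1 subr_ge0.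
Qed.
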